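(* Let $(\mathcal{A},R)$ and $(\mathcal{B},S)$ be Lie-Rinehart pairs, and let $(F,\psi)\colon(\mathcal{A},R)\to(\mathcal{B},S)$ be a comorphism of Lie-Rinehart pairs (so $\psi\colon S\to R$ and $F\colon\mathcal{A}\to R\otimes_S\mathcal{B}$). Let $(\psi^!\mathcal{B},R)$ be the base change of $(\mathcal{B},S)$ along $\psi$ and $(\pi_2,\psi)\colon(\psi^!\mathcal{B},R)\to(\mathcal{B},S)$ the canonical projection. Then there exists a unique comorphism of Lie-Rinehart pairs $(\underline{F},\mathrm{Id}_R)\colon(\mathcal{A},R)\to(\psi^!\mathcal{B},R)$ such that $$(F,\psi)=(\pi_2,\psi)\circ(\underline{F},\mathrm{Id}_R).$$
   Context: All algebras are commutative unital $\mathbb{R}$-algebras. $\mathrm{Der}(R)$ denotes the $\mathbb{R}$-linear derivations of $R$; given $\psi\colon S\to R$, $\mathrm{Der}(S,R)$ denotes the $\mathbb{R}$-linear derivations of $S$ with values in $R$ (an $S$-module via $\psi$). Lie-Rinehart (LR) pair $(\mathcal{A},R)$: an $\mathbb{R}$-algebra $R$, an $R$-module $\mathcal{A}$ with a real Lie bracket, and an $R$-linear Lie algebra homomorphism (the anchor) $\mathcal{A}\to\mathrm{Der}(R)$, $a\mapsto\mathcal{L}_a$, such that $[v,rw]=r[v,w]+\mathcal{L}_v(r)w$ for $v,w\in\mathcal{A}$, $r\in R$. Comorphism of LR pairs $(F,\psi)\colon(\mathcal{A},R)\to(\mathcal{B},S)$: an algebra homomorphism $\psi\colon S\to R$ and an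 $R$-linear map $F\colon\mathcal{A}\to R\otimes_S\mathcal{B}$ such that, whenever $F(a)=\sum_{i}c^i\otimes e_i$ and $F(b)=\sum_{j}d^j\otimes f_j$ (finite sums, $c^i,d^j\in R$, $e_i,f_j\in\mathcal{B}$): (a) $\mathcal{L}_a(\psi(s))=\sum_i c^i\psi(\mathcal{L}_{e_i}s)$ for all $s\in S$; (b) $F([a,b])=\sum_{i,j}c^id^j\otimes[e_i,f_j]+\sum_j\mathcal{L}_a(d^j)\otimes f_j-\sum_i\mathcal{L}_b(c^i)\otimes e_i$. A comorphism covering $\mathrm{Id}_R$ is thus an $R$-linear map commuting with anchors and brackets. The composition $(G,\chi)\circ(F,\psi)$ with $(G,\chi)\colon(\mathcal{B},S)\to(\mathcal{C},T)$ is $((\mathrm{Id}_R\otimes_S G)\circ F,\ \psi\circ\chi)$, using $R\otimes_S(S\otimes_T\mathcal{C})\cong R\otimes_T\mathcal{C}$. Base change: given an LR pair $(\mathcal{B},S)$ and an algebra homomorphism $\psi\colon S\to R$, $\psi^!\mathcal{B}$ is the fiber product of $R$-modules $\mathrm{Der}(R)\times_{\mathrm{Der}(S,R)}(R\otimes_S\mathcal{B})$, along $D\mapsto D\circ\psi$ and $c\otimes e\mapsto(s\mapsto c\,\psi(\mathcal{L}_e s))$. Its anchor is the projection to $\mathrm{Der}(R)$, and its bracket is $$\Big[\big(D,\sum_i c^i\otimes e_i\big),\big(D',\sum_j d^j\otimes f_j\big)\Big]=\Big(DD'-D'D,\ \sum_{i,j}c^id^j\otimes[e_i,f_j]+\sum_jD(d^j)\otimes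 f_j-\sum_iD'(c^i)\otimes e_i\Big).$$ This is an LR pair, and the projection $\pi_2\colon\psi^!\mathcal{B}\to R\otimes_S\mathcal{B}$ gives a comorphism of LR pairs $(\pi_2,\psi)\colon(\psi^!\mathcal{B},R)\to(\mathcal{B},S)$. *)

(* Defs.v *)
From HB Require Import structures.
From mathcomp Require Import all_boot all_order all_algebra.
From mathcomp Require Import boolp reals.

Set Implicit Arguments.
Unset Strict Implicit.
Unset Printing Implicit Defensive.

Import GRing.Theory Num.Theory.
Local Open Scope ring_scope.
Local Open Scope quotient_scope.

(* A commutative unital K-algebra, given by its structure morphism k |-> k.1; *)
(* here K stands for the field of real numbers.  The library's comAlgType K   *)
(* is not used because it excludes the zero algebra.                          *)
Record comAlg (K : realType) := ComAlg {
  comalg_ring :> comPzRingType;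
  comalg_in : {rmorphism K -> comalg_ring}
}.
Notation "k %:S" := (comalg_in _ k) (at level 2, format "k %:S").

Definition comAlg_of (K : realType) (R : comAlgType K) : comAlg K :=
  ComAlg (in_alg R).

Record alg_hom (K : realType) (S R : comAlg K) := AlgHom {
  alg_hom_fun :> {rmorphism S -> R};
  alg_hom_in : forall k : K, alg_hom_fun k%:S = k%:S
}.

Section AlgHom.
Variable K : realType.

Fact id_hom_in (R : comAlg K) (k : K) : (idfun : {rmorphism R -> R}) k%:S = k%:S.
Proof. by []. Qed.
Definition id_hom (R : comAlg K) : alg_hom R R := AlgHom (@id_hom_in R).

Variables (T S R : comAlg K) (psi : alg_hom S R) (chi : alg_hom T S).

Fact comp_hom_in k : (psi \o chi : {rmorphism T -> R}) k%:S = k%:S.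
Proof. by rewrite /= !alg_hom_in. Qed.
Definition comp_hom : alg_hom T R := AlgHom comp_hom_in.

End AlgHom.

(* Derivations of S with values in R, an S-module via psi.                    *)
Record der (K : realType) (S R : comAlg K) (psi : alg_hom S R) := MkDer {
  der_fun :> S -> R;
  derD : {morph der_fun : s t / s + t};
  derZ : forall (k : K) s, der_fun (k%:S * s) = k%:S * der_fun s;
  derM : forall s t, der_fun (s * t) = psi s * der_fun t + psi t * der_fun s
}.
Notation Der R := (der (id_hom R)).

Section Derivations.
Variables (K : realType) (S R : comAlg K) (psi : alg_hom S R).
Implicit Types (D E : der psi) (r : R).

Lemma der_ext D E : D =1 E -> D = E.
Proof.
case: D E => [f fD fZ fM] [g gD gZ gM] /= /funext e.
by move: fD fZ fM gD gZ gM; rewrite e => *; congr MkDer; apply: Prop_irrelevance.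
Qed.

Lemma der0 D : D 0 = 0.
Proof. by apply: (addIr (D 0)); rewrite -derD !add0r. Qed.
Lemma derN D x : D (- x) = - D x.
Proof. by apply: (addrI (D x)); rewrite -derD !subrr der0. Qed.
Lemma der1 D : D 1 = 0.
Proof.
apply: (addIr (D 1)); rewrite add0r -{3}[1]mulr1 derM rmorph1.
by rewrite mul1r.
Qed.
Lemma der_in D (k : K) : D k%:S = 0.
Proof. by rewrite -[k%:S]mulr1 derZ der1 mulr0. Qed.
Lemma der_sum D (I : Type) (s : seq I) (f : I -> S) :
  D (\sum_(i <- s) f i) = \sum_(i <- s) D (f i).
Proof. exact: (big_morph D (derD D) (der0 D)). Qed.

HB.instance Definition _ := gen_eqMixin (der psi).
HB.instance Definition _ := gen_choiceMixin (der psi).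

Fact zero_derD : {morph (fun _ : S => 0 : R) : s t / s + t}.
Proof. by move=> s t; rewrite addr0. Qed.
Fact zero_derZ (k : K) (s : S) : 0 = k%:S * 0 :> R.
Proof. by rewrite mulr0. Qed.
Fact zero_derM s t : 0 = psi s * 0 + psi t * 0.
Proof. by rewrite !mulr0 addr0. Qed.
Definition zero_der : der psi := MkDer zero_derD zero_derZ zero_derM.

Fact opp_derD D : {morph (fun s => - D s) : s t / s + t}.
Proof. by move=> s t; rewrite derD opprD. Qed.
Fact opp_derZ D (k : K) s : - D (k%:S * s) = k%:S * - D s.
Proof. by rewrite derZ mulrN. Qed.
Fact opp_derM D s t : - D (s * t) = psi s * - D t + psi t * - D s.
Proof. by rewrite derM opprD !mulrN. Qed.
Definition opp_der D : der psi := MkDer (opp_derD D) (opp_derZ D) (opp_derM D).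

Fact add_derD D E : {morph (fun s => D s + E s) : s t / s + t}.
Proof. by move=> s t; rewrite !derD addrACA. Qed.
Fact add_derZ D E (k : K) s :
  D (k%:S * s) + E (k%:S * s) = k%:S * (D s + E s).
Proof. by rewrite !derZ mulrDr. Qed.
Fact add_derM D E s t :
  D (s * t) + E (s * t) = psi s * (D t + E t) + psi t * (D s + E s).
Proof. by rewrite !derM !mulrDr addrACA. Qed.
Definition add_der D E : der psi :=
  MkDer (add_derD D E) (add_derZ D E) (add_derM D E).

Fact scale_derD r D : {morph (fun s => r * D s) : s t / s + t}.
Proof. by move=> s t; rewrite derD mulrDr. Qed.
Fact scale_derZ r D (k : K) s : r * D (k%:S * s) = k%:S * (r * D s).
Proof. by rewrite derZ mulrCA. Qed.
Fact scale_derM r D s t :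
  r * D (s * t) = psi s * (r * D t) + psi t * (r * D s).
Proof. by rewrite derM mulrDr !(mulrCA r). Qed.
Definition scale_der r D : der psi :=
  MkDer (scale_derD r D) (scale_derZ r D) (scale_derM r D).

Fact add_derA : associative add_der.
Proof. by move=> D E F; apply: der_ext => s /=; rewrite addrA. Qed.
Fact add_derC : commutative add_der.
Proof. by move=> D E; apply: der_ext => s /=; rewrite addrC. Qed.
Fact add_der0 : left_id zero_der add_der.
Proof. by move=> D; apply: der_ext => s /=; rewrite add0r. Qed.
Fact add_derN : left_inverse zero_der opp_der add_der.
Proof. by move=> D; apply: der_ext => s /=; rewrite addNr. Qed.
HB.instance Definition _ :=
  GRing.isZmodule.Build (der psi) add_derA add_derC add_der0 add_derN.

Fact scale_derA a b D : scale_der a (scale_der b D) = scale_der (a * b) D.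
Proof. by apply: der_ext => s /=; rewrite mulrA. Qed.
Fact scale_der1 : left_id 1 scale_der.
Proof. by move=> D; apply: der_ext => s /=; rewrite mul1r. Qed.
Fact scale_derDr : right_distributive scale_der +%R.
Proof. by move=> r D E; apply: der_ext => s /=; rewrite mulrDr. Qed.
Fact scale_derDl D : {morph scale_der^~ D : a b / a + b}.
Proof. by move=> a b; apply: der_ext => s /=; rewrite mulrDl. Qed.
HB.instance Definition _ := GRing.Zmodule_isLmodule.Build R (der psi)
  scale_derA scale_der1 scale_derDr scale_derDl.

Lemma zero_derE s : (0 : der psi) s = 0. Proof. by []. Qed.
Lemma opp_derE D s : (- D) s = - D s. Proof. by []. Qed.
Lemma add_derE D E s : (D + E) s = D s + E s. Proof. by []. Qed.
Lemma scale_derE r D s : (r *: D) s = r * D s. Proof. by []. Qed.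
Lemma sum_derE (I : Type) (l : seq I) (f : I -> der psi) s :
  (\sum_(i <- l) f i) s = \sum_(i <- l) f i s.
Proof. exact: (big_morph (fun D : der psi => D s)). Qed.

End Derivations.

Section DerivationOperations.
Variables (K : realType) (S R : comAlg K) (psi : alg_hom S R).

Section Commutator.
Variables D E : Der R.

Fact comm_derD : {morph (fun r => D (E r) - E (D r)) : s t / s + t}.
Proof. by move=> s t; rewrite !derD opprD addrACA. Qed.
Fact comm_derZ (k : K) s :
  D (E (k%:S * s)) - E (D (k%:S * s)) = k%:S * (D (E s) - E (D s)).
Proof. by rewrite !derZ mulrBr. Qed.
Fact comm_derM (s t : R) :
  D (E (s * t)) - E (D (s * t)) =
    s * (D (E t) - E (D t)) + t * (D (E s) - E (D s)).
Proof.
rewrite !(derM, derD) /= (mulrC (D s)) (mulrC (D t)) .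
rewrite [X in _ - X](AC (2*2) ((1*4)*(3*2))) /= opprD addrACA.
have subK (a b c : R) : a + b - (c + b) = a - c.
  by rewrite opprD addrACA subrr addr0.
by rewrite !subK !mulrBr.
Qed.
Definition comm_der : Der R :=
  @MkDer K R R (id_hom R) _ comm_derD comm_derZ comm_derM.
End Commutator.

Section Precomposition.
Variable D : Der R.

Fact der_precompD : {morph D \o psi : s t / s + t}.
Proof. by move=> s t; rewrite /= rmorphD derD. Qed.
Fact der_precompZ (k : K) s : D (psi (k%:S * s)) = k%:S * D (psi s).
Proof. by rewrite rmorphM /= alg_hom_in derZ. Qed.
Fact der_precompM s t :
  D (psi (s * t)) = psi s * D (psi t) + psi t * D (psi s).
Proof. by rewrite rmorphM derM. Qed.
Definition der_precomp : der psi :=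
  @MkDer K S R psi (D \o psi) der_precompD der_precompZ der_precompM.
End Precomposition.

Section Postcomposition.
Variable D : Der S.

Fact der_postcompD : {morph psi \o D : s t / s + t}.
Proof. by move=> s t; rewrite /= derD rmorphD. Qed.
Fact der_postcompZ (k : K) s : psi (D (k%:S * s)) = k%:S * psi (D s).
Proof. by rewrite derZ rmorphM /= alg_hom_in. Qed.
Fact der_postcompM s t :
  psi (D (s * t)) = psi s * psi (D t) + psi t * psi (D s).
Proof. by rewrite derM rmorphD !rmorphM. Qed.
Definition der_postcomp : der psi :=
  @MkDer K S R psi (psi \o D) der_postcompD der_postcompZ der_postcompM.
End Postcomposition.

Fact der_precomp_linear : linear der_precomp.
Proof. by move=> r D E; apply: der_ext. Qed.
HB.instance Definition _ := GRing.isLinear.Build R (Der R) (der psi) _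
  der_precomp der_precomp_linear.

End DerivationOperations.

(* Formal sums  \sum_i c_i (x) e_i  are sequences of pairs (c_i, e_i); the    *)
(* tensor product is their quotient by the least congruence for concatenation *)
(* which makes (x) biadditive and balanced over S.  Classes have opposites    *)
(* since  (- c) (x) e + c (x) e = 0 (x) e = 0.                                *)
Section TensorRelation.
Variables (S R : comPzRingType) (psi : {rmorphism S -> R}) (B : lmodType S).

Inductive tens_rel : seq (R * B) -> seq (R * B) -> Prop :=
| tens_refl x : tens_rel x x
| tens_sym x y : tens_rel x y -> tens_rel y x
| tens_trans y x z : tens_rel x y -> tens_rel y z -> tens_rel x z
| tens_cat x x' y y' :
    tens_rel x x' -> tens_rel y y' -> tens_rel (x ++ y) (x' ++ y')
| tens_comm x y : tens_rel (x ++ y) (y ++ x)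
| tens_zero e : tens_rel [:: (0, e)] [::]
| tens_addl c c' e : tens_rel [:: (c + c', e)] [:: (c, e); (c', e)]
| tens_addr c e e' : tens_rel [:: (c, e + e')] [:: (c, e); (c, e')]
| tens_bal c s e : tens_rel [:: (c * psi s, e)] [:: (c, s *: e)].

Definition tens_relb x y := `[< tens_rel x y >].
Fact tens_relb_refl : reflexive tens_relb.
Proof. by move=> x; apply/asboolP/tens_refl. Qed.
Fact tens_relb_sym : symmetric tens_relb.
Proof. by move=> x y; apply/asboolP/asboolP; apply: tens_sym. Qed.
Fact tens_relb_trans : transitive tens_relb.
Proof.
move=> y x z /asboolP xy /asboolP yz; apply/asboolP; exact: tens_trans xy yz.
Qed.
Canonical tens_equiv := EquivRel tens_relb
  tens_relb_refl tens_relb_sym tens_relb_trans.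

Definition tensor := {eq_quot tens_equiv}.
HB.instance Definition _ := EqQuotient.on tensor.
HB.instance Definition _ := Choice.on tensor.

Definition tclass (x : seq (R * B)) : tensor := \pi_tensor x.

Lemma tclassP x y : tclass x = tclass y <-> tens_rel x y.
Proof.
by split=> [/eqmodP/asboolP // | xy]; apply/eqmodP/asboolP.
Qed.
Lemma tclassK (t : tensor) : tclass (repr t) = t. Proof. exact: reprK. Qed.

Definition tadd (t u : tensor) := tclass (repr t ++ repr u).
Definition tscale (r : R) (t : tensor) :=
  tclass [seq (r * p.1, p.2) | p <- repr t].

Lemma tens_repr x : tens_rel (repr (tclass x)) x.
Proof. by apply/tclassP; rewrite tclassK. Qed.

Lemma taddE x y : tadd (tclass x) (tclass y) = tclass (x ++ y).
Proof. by apply/tclassP/tens_cat; apply: tens_repr. Qed.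

Lemma tens_rel_scale r x y : tens_rel x y ->
  tens_rel [seq (r * p.1, p.2) | p <- x] [seq (r * p.1, p.2) | p <- y].
Proof.
elim=> {x y} [x|x y _ IH|y x z _ IH1 _ IH2|x x' y y' _ IH1 _ IH2|x y|e|c c' e
  |c e e'|c s e] //=.
- exact: tens_refl.
- exact: tens_sym.
- exact: tens_trans IH1 IH2.
- by rewrite !map_cat; apply: tens_cat.
- by rewrite !map_cat; apply: tens_comm.
- by rewrite mulr0; apply: tens_zero.
- by rewrite mulrDr; apply: tens_addl.
- exact: tens_addr.
- by rewrite mulrA; apply: tens_bal.
Qed.

Lemma tscaleE r x : tscale r (tclass x) = tclass [seq (r * p.1, p.2) | p <- x].
Proof. by apply/tclassP/tens_rel_scale/tens_repr. Qed.

Lemma tensor_ind (P : tensor -> Prop) : (forall x, P (tclass x)) -> forall t, P t.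
Proof. by move=> Px t; rewrite -[t]tclassK. Qed.

Fact taddA : associative tadd.
Proof.
elim/tensor_ind=> x; elim/tensor_ind=> y; elim/tensor_ind=> z.
by rewrite !taddE catA.
Qed.
Fact taddC : commutative tadd.
Proof.
elim/tensor_ind=> x; elim/tensor_ind=> y; rewrite !taddE.
exact/tclassP/tens_comm.
Qed.
Fact tadd0 : left_id (tclass [::]) tadd.
Proof. by elim/tensor_ind=> x; rewrite taddE. Qed.
Fact tadd_scale r r' t : tscale (r + r') t = tadd (tscale r t) (tscale r' t).
Proof.
have consE p x : tclass (p :: x) = tadd (tclass [:: p]) (tclass x).
  by rewrite taddE.
elim/tensor_ind: t => x; rewrite !tscaleE; elim: x => [|[c e] x IH] /=.
  by rewrite taddE.
have cE : tclass [:: ((r + r') * c, e)]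
    = tadd (tclass [:: (r * c, e)]) (tclass [:: (r' * c, e)]).
  by rewrite taddE mulrDl; apply/tclassP/tens_addl.
rewrite consE IH cE (consE (r * c, e) (map _ _)) (consE (r' * c, e) (map _ _)).
set t1 := tclass [:: (r * c, e)]; set t2 := tclass [:: (r' * c, e)].
by rewrite -taddA (taddA t2) (taddC t2) -taddA taddA.
Qed.
Fact tscale1 : left_id 1 tscale.
Proof.
elim/tensor_ind=> x; rewrite tscaleE; congr tclass.
by rewrite -[RHS]map_id; apply: eq_map => -[c e] /=; rewrite mul1r.
Qed.
Fact tscale0 t : tscale 0 t = tclass [::].
Proof.
elim/tensor_ind: t => x; rewrite tscaleE; apply/tclassP.
elim: x => [|[c e] x IH] /=; first exact: tens_refl.
by rewrite mul0r; apply: (tens_cat (tens_zero e) IH).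
Qed.
Fact taddN : left_inverse (tclass [::]) (tscale (-1)) tadd.
Proof. by move=> t; rewrite -{2}[t]tscale1 -tadd_scale addNr tscale0. Qed.
HB.instance Definition _ := GRing.isZmodule.Build tensor taddA taddC tadd0 taddN.

Fact tscaleA r r' t : tscale r (tscale r' t) = tscale (r * r') t.
Proof.
elim/tensor_ind: t => x; rewrite !tscaleE -map_comp; congr tclass.
by apply: eq_map => p /=; rewrite mulrA.
Qed.
Fact tscaleDr : right_distributive tscale +%R.
Proof.
move=> r; elim/tensor_ind=> x; elim/tensor_ind=> y.
by rewrite [_ + _]taddE !tscaleE [RHS]taddE map_cat.
Qed.
Fact tscaleDl t : {morph tscale^~ t : r r' / r + r'}.
Proof. by move=> r r'; apply: tadd_scale. Qed.
HB.instance Definition _ := GRing.Zmodule_isLmodule.Build R tensor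
  tscaleA tscale1 tscaleDr tscaleDl.

Definition tens (c : R) (e : B) : tensor := tclass [:: (c, e)].

Definition tsum (x : seq (R * B)) : tensor := \sum_(p <- x) tens p.1 p.2.

Lemma tsumE x : tsum x = tclass x.
Proof.
rewrite /tsum; elim: x => [|[c e] x IH]; first by rewrite big_nil.
by rewrite big_cons IH [LHS]taddE.
Qed.
Lemma tsum_repr t : tsum (repr t) = t.
Proof. by rewrite tsumE tclassK. Qed.
Lemma tsum_cat x y : tsum (x ++ y) = tsum x + tsum y.
Proof. exact: big_cat. Qed.

Lemma tensDl c c' e : tens (c + c') e = tens c e + tens c' e.
Proof. by rewrite [RHS]taddE; apply/tclassP/tens_addl. Qed.
Lemma tensDr c e e' : tens c (e + e') = tens c e + tens c e'.
Proof. by rewrite [RHS]taddE; apply/tclassP/tens_addr. Qed.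
Lemma tensM c s e : tens (c * psi s) e = tens c (s *: e).
Proof. exact/tclassP/tens_bal. Qed.
Lemma tensZ r c e : r *: tens c e = tens (r * c) e.
Proof. exact: tscaleE. Qed.
Lemma tensNl c e : tens (- c) e = - tens c e.
Proof. by rewrite -scaleN1r tensZ mulN1r. Qed.
Lemma tens0l e : tens 0 e = 0.
Proof. by rewrite -(mul0r 0) -tensZ scale0r. Qed.
Lemma tens0r c : tens c 0 = 0.
Proof. by apply: (addIr (tens c 0)); rewrite -tensDr !add0r. Qed.
Lemma tensNr c e : tens c (- e) = - tens c e.
Proof. by apply: (addrI (tens c e)); rewrite -tensDr !subrr tens0r. Qed.
Lemma tens_suml (I : Type) (s : seq I) (f : I -> R) e :
  tens (\sum_(i <- s) f i) e = \sum_(i <- s) tens (f i) e.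
Proof. exact: (big_morph (tens^~ e) (fun c c' => tensDl c c' e) (tens0l e)). Qed.
Lemma tens_sumr (I : Type) (s : seq I) c (f : I -> B) :
  tens c (\sum_(i <- s) f i) = \sum_(i <- s) tens c (f i).
Proof. exact: (big_morph (tens c) (tensDr c) (tens0r c)). Qed.

Section Lift.
Variables (M : zmodType) (f : R -> B -> M).

Record balanced : Prop := Balanced {
  balDl : forall c c' e, f (c + c') e = f c e + f c' e;
  balDr : forall c e e', f c (e + e') = f c e + f c e';
  balM : forall c s e, f (c * psi s) e = f c (s *: e)
}.

Definition tlift (t : tensor) : M := \sum_(p <- repr t) f p.1 p.2.

Hypothesis f_bal : balanced.

Lemma tens_rel_lift x y : tens_rel x y ->
  \sum_(p <- x) f p.1 p.2 = \sum_(p <- y) f p.1 p.2.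
Proof.
case: f_bal => fDl fDr fM.
elim=> {x y} [x|x y _ IH|y x z _ IH1 _ IH2|x x' y y' _ IH1 _ IH2|x y|e|c c' e
  |c e e'|c s e] //.
- by rewrite IH1.
- by rewrite !big_cat IH1 IH2.
- by rewrite !big_cat /= addrC.
- rewrite big_seq1 big_nil /=; apply: (addIr (f 0 e)).
  by rewrite -fDl !add0r.
- by rewrite big_seq1 big_cons big_seq1 fDl.
- by rewrite big_seq1 big_cons big_seq1 fDr.
- by rewrite !big_seq1 fM.
Qed.

Lemma tlift_sum x : tlift (tsum x) = \sum_(p <- x) f p.1 p.2.
Proof. by rewrite tsumE; apply/tens_rel_lift/tens_repr. Qed.
Lemma tliftE c e : tlift (tens c e) = f c e.
Proof.
by have := tlift_sum [:: (c, e)]; rewrite /tsum !big_seq1.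
Qed.
Lemma tliftD : {morph tlift : t u / t + u}.
Proof.
move=> t u; rewrite -[t]tsum_repr -[u]tsum_repr -tsum_cat !tlift_sum.
exact: big_cat.
Qed.
Lemma tlift0 : tlift 0 = 0.
Proof. by apply: (addIr (tlift 0)); rewrite -tliftD !add0r. Qed.
End Lift.

Lemma tlift_linear (M : lmodType R) (f : R -> B -> M) : balanced f ->
  (forall r c e, f (r * c) e = r *: f c e) -> linear (tlift f).
Proof.
move=> f_bal fZ r t u; rewrite tliftD //; congr (_ + _).
rewrite -[t]tsum_repr /tsum scaler_sumr.
rewrite !(big_morph _ (tliftD f_bal) (tlift0 f_bal)) scaler_sumr.
by apply: eq_bigr => p _; rewrite tensZ !tliftE.
Qed.

End TensorRelation.

(* lr_mod is a real vector space by restriction of scalars: k acts as k%:S.   *)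
Record lr_pair (K : realType) (R : comAlg K) := LRPair {
  lr_mod :> lmodType R;
  lr_bracket : lr_mod -> lr_mod -> lr_mod;
  lr_anchor : {linear lr_mod -> Der R};
  lr_bracketDl : forall a a' b,
    lr_bracket (a + a') b = lr_bracket a b + lr_bracket a' b;
  lr_bracketDr : forall a b b',
    lr_bracket a (b + b') = lr_bracket a b + lr_bracket a b';
  lr_bracketZl : forall (k : K) a b,
    lr_bracket (k%:S *: a) b = k%:S *: lr_bracket a b;
  lr_bracketZr : forall (k : K) a b,
    lr_bracket a (k%:S *: b) = k%:S *: lr_bracket a b;
  lr_bracketxx : forall a, lr_bracket a a = 0;
  lr_jacobi : forall a b c,
    lr_bracket a (lr_bracket b c) + lr_bracket b (lr_bracket c a)
      + lr_bracket c (lr_bracket a b) = 0;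
  lr_anchor_bracket : forall a b,
    lr_anchor (lr_bracket a b) = comm_der (lr_anchor a) (lr_anchor b);
  lr_leibniz : forall a b (r : R),
    lr_bracket a (r *: b) = r *: lr_bracket a b + lr_anchor a r *: b
}.

Section LRPairTheory.
Variables (K : realType) (R : comAlg K) (A : lr_pair R).
Implicit Types a b : A.

Lemma lr_bracketC a b : lr_bracket a b = - lr_bracket b a.
Proof.
apply/eqP; rewrite -addr_eq0; apply/eqP.
have := lr_bracketxx (a + b).
by rewrite lr_bracketDl !lr_bracketDr !lr_bracketxx add0r addr0.
Qed.
End LRPairTheory.

Section ZmoduleSums.
Variable M : zmodType.
Implicit Types u v w : M.

Lemma subr_swap u v u' v' : u - v + (u' - v') = u - v' + (u' - v).
Proof. by rewrite addrACA [- v - v']addrC addrACA. Qed.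
Lemma addr_split3 u v w u' v' w' :
  (u + u') + (v + v') + (w + w') = (u + v + w) + (u' + v' + w').
Proof. by rewrite (addrACA u) (addrACA (u + v)). Qed.
Lemma subr_cycle3 u v w : u - v + (v - w) + (w - u) = 0.
Proof. by rewrite !subrKA subrr. Qed.
Lemma subr_cycle3' u v w : u - v + (w - u) + (v - w) = 0.
Proof. by rewrite [u - v + _]addrC subr_cycle3. Qed.
Lemma jacobi_sum0 t1 t2 t3 a b c d e f g h i j k l : t1 + t2 + t3 = 0 :> M ->
    (t1 + (a - b) + (d - e) + (g - h) + (j - k))
  + (t2 + (c - a) + (f - d) + (h - i) + (k - l))
  + (t3 + (b - c) + (e - f) + (i - g) + (l - j)) = 0.
Proof.
move=> t0; rewrite addr_split3 subr_cycle3 addr0 addr_split3 subr_cycle3 addr0.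
by rewrite addr_split3 subr_cycle3' addr0 addr_split3 subr_cycle3' addr0.
Qed.
Lemma commutator_sum0 a b c d e f :
  (a - b - (c - d)) + (c - e - (f - b)) + (f - d - (a - e)) = 0 :> M.
Proof.
rewrite !opprB (subr_swap a) (subr_swap c) (subr_swap f).
by rewrite addr_split3 !subr_cycle3 addr0.
Qed.
End ZmoduleSums.

Section TensorBracket.
Variables (K : realType) (S R : comAlg K) (psi : alg_hom S R) (B : lr_pair S).
Local Notation T := (tensor psi B).

Definition tens_anchor : T -> der psi :=
  tlift (fun c e => c *: der_postcomp psi (lr_anchor B e)).

Fact tens_anchor_balanced :
  balanced psi (fun c (e : B) => c *: der_postcomp psi (lr_anchor B e)).
Proof.
split=> [c c' e|c e e'|c s e]; first exact: scalerDl.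
  rewrite -scalerDr; congr (_ *: _); apply: der_ext => t /=.
  by rewrite raddfD /= rmorphD.
rewrite -scalerA; congr (_ *: _); apply: der_ext => t /=.
by rewrite linearZ /= rmorphM.
Qed.

Fact tens_anchor_linear : linear tens_anchor.
Proof.
apply: tlift_linear; first exact: tens_anchor_balanced.
by move=> r c e; rewrite scalerA.
Qed.
HB.instance Definition _ := GRing.isLinear.Build R T (der psi) _
  tens_anchor tens_anchor_linear.

Lemma tens_anchorE x s :
  tens_anchor (tsum psi x) s = \sum_(p <- x) p.1 * psi (lr_anchor B p.2 s).
Proof. by rewrite /tens_anchor tlift_sum ?sum_derE //; apply: tens_anchor_balanced. Qed.

(* The sum  \sum_ij c_i d_j (x) [e_i, f_j] + \sum_j D(d_j) (x) f_j             *)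
(*                                           - \sum_i D'(c_i) (x) e_i         *)
(* for the formal sums x = \sum_i c_i (x) e_i and y = \sum_j d_j (x) f_j.     *)
(* It is a function of the classes of x and y only under the compatibility    *)
(* conditions of tbracket_repr.                                               *)
Definition tbracket (D : Der R) (x : seq (R * B)) (D' : Der R)
    (y : seq (R * B)) : T :=
  \sum_(p <- x) \sum_(q <- y) tens psi (p.1 * q.1) (lr_bracket p.2 q.2)
  + \sum_(q <- y) tens psi (D q.1) q.2 - \sum_(p <- x) tens psi (D' p.1) p.2.

Lemma tbracketC D x D' y : tbracket D x D' y = - tbracket D' y D x.
Proof.
rewrite /tbracket exchange_big /= !opprD opprK -!addrA.
congr (_ + _); last by rewrite addrC.
rewrite -sumrN; apply: eq_bigr => q _; rewrite -sumrN; apply: eq_bigr => p _.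
by rewrite lr_bracketC mulrC tensNr.
Qed.

Lemma tbracket_reprr D x D' y y' : der_precomp psi D = tens_anchor (tsum psi x) ->
  tsum psi y = tsum psi y' -> tbracket D x D' y = tbracket D x D' y'.
Proof.
move=> Dx eyy'.
pose f d (g : B) :=
  \sum_(p <- x) tens psi (p.1 * d) (lr_bracket p.2 g) + tens psi (D d) g.
have f_bal : balanced psi f.
  split=> [d d' g|d g g'|d s g]; rewrite /f.
  - rewrite derD tensDl addrACA -big_split /=; congr (_ + _).
    by apply: eq_bigr => p _; rewrite mulrDr tensDl.
  - rewrite tensDr addrACA -big_split /=; congr (_ + _).
    by apply: eq_bigr => p _; rewrite lr_bracketDr tensDr.
  have -> : tens psi (D (d * psi s)) g
      = tens psi (D d * psi s) g
        + \sum_(p <- x) tens psi (p.1 * d) (lr_anchor B p.2 s *: g).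
    rewrite derM tensDl addrC mulrC; congr (_ + _).
    rewrite -[D _]/(der_precomp psi D s) Dx tens_anchorE mulr_sumr tens_suml.
    by apply: eq_bigr => p _; rewrite -tensM /= mulrA [d * _]mulrC.
  rewrite tensM addrCA addrC; congr (_ + _); rewrite -big_split /=.
  by apply: eq_bigr => p _; rewrite lr_leibniz tensDr mulrA tensM.
have fE z : \sum_(p <- x) \sum_(q <- z) tens psi (p.1 * q.1) (lr_bracket p.2 q.2)
    + \sum_(q <- z) tens psi (D q.1) q.2 = tlift f (tsum psi z).
  by rewrite tlift_sum // exchange_big /= -big_split.
by rewrite /tbracket !fE eyy'.
Qed.

Lemma tbracket_repr D x x' D' y y' :
    der_precomp psi D = tens_anchor (tsum psi x) ->
    der_precomp psi D' = tens_anchor (tsum psi y) ->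
    tsum psi x = tsum psi x' -> tsum psi y = tsum psi y' ->
  tbracket D x D' y = tbracket D x' D' y'.
Proof.
move=> Dx Dy exx' eyy'; rewrite (tbracket_reprr _ Dx eyy').
rewrite tbracketC (@tbracket_reprr D' y' D x x') ?Dy ?eyy' //.
by rewrite -tbracketC.
Qed.

Lemma tens_anchor_tbracket D x D' y :
    der_precomp psi D = tens_anchor (tsum psi x) ->
    der_precomp psi D' = tens_anchor (tsum psi y) ->
  der_precomp psi (comm_der D D') = tens_anchor (tbracket D x D' y).
Proof.
move=> Dx Dy; apply: der_ext => s /=.
have Dxs s' : D (psi s') = \sum_(p <- x) p.1 * psi (lr_anchor B p.2 s').
  by rewrite -tens_anchorE -Dx.
have Dys s' : D' (psi s') = \sum_(p <- y) p.1 * psi (lr_anchor B p.2 s').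
  by rewrite -tens_anchorE -Dy.
have ancE c (e : B) : tens_anchor (tens psi c e) s = c * psi (lr_anchor B e s).
  by have := tens_anchorE [:: (c, e)] s; rewrite /tsum !big_seq1.
have ancS (I : Type) (l : seq I) (f : I -> T) :
    tens_anchor (\sum_(i <- l) f i) s = \sum_(i <- l) tens_anchor (f i) s.
  by rewrite raddf_sum sum_derE.
rewrite Dxs Dys !der_sum /tbracket raddfB raddfD add_derE add_derE opp_derE.
rewrite !ancS.
under eq_bigr do rewrite derM /= Dxs mulr_sumr.
under [X in _ - X]eq_bigr do rewrite derM /= Dys mulr_sumr.
under [X in _ = X + _ + _]eq_bigr => p _.
  rewrite ancS.
  under eq_bigr do rewrite ancE lr_anchor_bracket /= rmorphB mulrBr.
  rewrite sumrB /=.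
  over.
under [X in _ = _ + X + _]eq_bigr do rewrite ancE.
under [X in _ = _ + _ - X]eq_bigr do rewrite ancE.
rewrite !big_split /=.
rewrite sumrN exchange_big /=; set u := \sum_(i <- x) \sum_(j <- y) _.
have -> : u = \sum_(i <- x) \sum_(j <- y)
    i.1 * j.1 * psi (lr_anchor B i.2 (lr_anchor B j.2 s)).
  by apply: eq_bigr => i _; apply: eq_bigr => j _; rewrite mulrCA mulrA.
under [X in _ - (X + _)]eq_bigr do under eq_bigr do rewrite mulrA.
under [X in _ + X - _]eq_bigr do rewrite mulrC.
under [X in _ - (_ + X)]eq_bigr do rewrite mulrC.
by rewrite opprD addrACA addrA.
Qed.

(* Formal sums computing tbracket, used only to prove the Jacobi identity.    *)
Let fder (D : Der R) (x : seq (R * B)) := [seq (D p.1, p.2) | p <- x].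
Let fopp (x : seq (R * B)) := [seq (- p.1, p.2) | p <- x].
Let fbr (x y : seq (R * B)) :=
  [seq (p.1 * q.1, lr_bracket p.2 q.2) | p <- x, q <- y].
Let fbracket D x D' y := fbr x y ++ fder D y ++ fopp (fder D' x).

Let tsum_fbr x y : tsum psi (fbr x y) =
  \sum_(p <- x) \sum_(q <- y) tens psi (p.1 * q.1) (lr_bracket p.2 q.2).
Proof. exact: big_allpairs_dep. Qed.
Let tsum_fder D x : tsum psi (fder D x) = \sum_(p <- x) tens psi (D p.1) p.2.
Proof. exact: big_map. Qed.
Let tsum_fopp x : tsum psi (fopp x) = - tsum psi x.
Proof.
by rewrite /tsum big_map -sumrN; apply: eq_bigr => p _; rewrite tensNl.
Qed.

Let tbracketE D x D' y : tbracket D x D' y = tsum psi (fbracket D x D' y).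
Proof. by rewrite !tsum_cat tsum_fbr tsum_fopp !tsum_fder addrA. Qed.

Let fbrC x y : tsum psi (fbr x y) = - tsum psi (fbr y x).
Proof.
rewrite !tsum_fbr exchange_big /= -sumrN; apply: eq_bigr => q _.
by rewrite -sumrN; apply: eq_bigr => p _; rewrite lr_bracketC mulrC tensNr.
Qed.
Let fbrDr x y z : tsum psi (fbr x (y ++ z)) = tsum psi (fbr x y) + tsum psi (fbr x z).
Proof.
by rewrite !tsum_fbr -big_split /=; apply: eq_bigr => p _; rewrite big_cat.
Qed.
Let fbrNr x y : tsum psi (fbr x (fopp y)) = - tsum psi (fbr x y).
Proof.
rewrite !tsum_fbr -sumrN; apply: eq_bigr => p _; rewrite big_map -sumrN.
by apply: eq_bigr => q _; rewrite /= mulrN tensNl.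
Qed.
Let fderN D x : tsum psi (fder D (fopp x)) = - tsum psi (fder D x).
Proof.
rewrite !tsum_fder -sumrN big_map.
by apply: eq_bigr => p _; rewrite /= derN tensNl.
Qed.
Let fder_fbr D x y : tsum psi (fder D (fbr x y)) =
  tsum psi (fbr x (fder D y)) - tsum psi (fbr y (fder D x)).
Proof.
rewrite (fbrC y) opprK tsum_fder big_allpairs_dep !tsum_fbr big_map.
rewrite -big_split /=; apply: eq_bigr => p _.
rewrite big_map -big_split /=; apply: eq_bigr => q _.
by rewrite derM /= tensDl [q.1 * _]mulrC.
Qed.
Let fder_comm D D' x : tsum psi (fder (comm_der D D') x) =
  tsum psi (fder D (fder D' x)) - tsum psi (fder D' (fder D x)).
Proof.
rewrite !tsum_fder !big_map -sumrB; apply: eq_bigr => p _ /=.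
by rewrite tensDl tensNl.
Qed.
Let fbr_jacobi x y z : tsum psi (fbr x (fbr y z)) + tsum psi (fbr y (fbr z x))
  + tsum psi (fbr z (fbr x y)) = 0.
Proof.
pose G (p q r : R * B) :=
  tens psi (p.1 * (q.1 * r.1)) (lr_bracket p.2 (lr_bracket q.2 r.2)).
have E u v w : tsum psi (fbr u (fbr v w)) =
    \sum_(p <- u) \sum_(q <- v) \sum_(r <- w) G p q r.
  by rewrite tsum_fbr; apply: eq_bigr => p _; apply: big_allpairs_dep.
have -> : tsum psi (fbr y (fbr z x)) =
    \sum_(p <- x) \sum_(q <- y) \sum_(r <- z) G q r p.
  rewrite E; under eq_bigr do rewrite exchange_big.
  by rewrite exchange_big.
have -> : tsum psi (fbr z (fbr x y)) =
    \sum_(p <- x) \sum_(q <- y) \sum_(r <- z) G r p q.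
  rewrite E exchange_big; apply: eq_bigr => p _; exact: exchange_big.
rewrite E -!big_split /= big1 // => p _.
rewrite -!big_split /= big1 // => q _; rewrite -!big_split /= big1 // => r _.
have eq_q : q.1 * (r.1 * p.1) = p.1 * (q.1 * r.1) by rewrite mulrA mulrC.
have eq_r : r.1 * (p.1 * q.1) = p.1 * (q.1 * r.1) by rewrite mulrC mulrA.
by rewrite /G eq_q eq_r -!tensDr lr_jacobi tens0r.
Qed.

Let tbracket_jacobi_formal D1 x D2 y D3 z :
    tbracket D1 x (comm_der D2 D3) (fbracket D2 y D3 z)
  + tbracket D2 y (comm_der D3 D1) (fbracket D3 z D1 x)
  + tbracket D3 z (comm_der D1 D2) (fbracket D1 x D2 y) = 0.
Proof.
pose U u E v := tsum psi (fbr u (fder E v)).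
pose V E E' v := tsum psi (fder E (fder E' v)).
have E D u D' v D'' w : tbracket D u (comm_der D' D'') (fbracket D' v D'' w)
  = tsum psi (fbr u (fbr v w)) + (U u D' w - U w D v)
    + (U v D w - U u D'' v) + (V D D' w - V D' D'' u)
    + (V D'' D' u - V D D'' v).
  rewrite tbracketE [fbracket D _ _ _]/fbracket !tsum_cat !fbrDr fbrNr.
  rewrite tsum_fopp fder_comm /fder !map_cat !tsum_cat -!/(fder _ _).
  rewrite fderN fder_fbr opprB -/(U _ _ _) -/(U _ _ _) -/(U _ _ _) -/(U _ _ _).
  rewrite -/(V _ _ _) -/(V _ _ _) -/(V _ _ _) -/(V _ _ _).
  move: (tsum _ _) (U _ _ _) (U _ _ _) (U _ _ _) (U _ _ _).
  move: (V _ _ _) (V _ _ _) (V _ _ _) (V _ _ _) => v1 v2 v3 v4 t u1 u2 u3 u4.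
  transitivity (t + (u4 - u3 + (u2 - u1)) + (v4 - v3 + (v2 - v1))).
    by rewrite !addrA.
  by rewrite subr_swap [v4 - v3 + _]subr_swap !addrA.
rewrite !E; exact: jacobi_sum0 (fbr_jacobi x y z).
Qed.

Lemma tbracket_jacobi D1 x D2 y D3 z :
    der_precomp psi D1 = tens_anchor (tsum psi x) ->
    der_precomp psi D2 = tens_anchor (tsum psi y) ->
    der_precomp psi D3 = tens_anchor (tsum psi z) ->
    tbracket D1 x (comm_der D2 D3) (repr (tbracket D2 y D3 z))
  + tbracket D2 y (comm_der D3 D1) (repr (tbracket D3 z D1 x))
  + tbracket D3 z (comm_der D1 D2) (repr (tbracket D1 x D2 y)) = 0.
Proof.
move=> Dx Dy Dz; rewrite -(tbracket_jacobi_formal D1 x D2 y D3 z).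
congr (_ + _ + _); apply: tbracket_reprr => //; rewrite tsum_repr; exact: tbracketE.
Qed.

Lemma tbracketDr D x D' y D'' z : tbracket D x (D' + D'') (y ++ z) =
  tbracket D x D' y + tbracket D x D'' z.
Proof.
rewrite !tbracketE !tsum_cat !fbrDr !tsum_fopp !tsum_fder big_cat /=.
have -> : \sum_(p <- x) tens psi ((D' + D'') p.1) p.2 =
    \sum_(p <- x) tens psi (D' p.1) p.2 + \sum_(p <- x) tens psi (D'' p.1) p.2.
  by rewrite -big_split; apply: eq_bigr => p _; rewrite add_derE tensDl.
by rewrite [RHS]addrACA; congr (_ + _); rewrite opprD addrACA.
Qed.

Lemma tbracketZr D x D' y (r : R) :
  tbracket D x (r *: D') [seq (r * p.1, p.2) | p <- y] =
  r *: tbracket D x D' y + D r *: tsum psi y.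
Proof.
rewrite /tbracket !big_map scalerBr scalerDr !scaler_sumr -!addrA.
congr (_ + _).
  apply: eq_bigr => p _; rewrite big_map scaler_sumr; apply: eq_bigr => q _.
  by rewrite tensZ mulrCA.
rewrite [X in _ = _ + X]addrC addrA; congr (_ - _); last first.
  by apply: eq_bigr => p _; rewrite tensZ.
rewrite -big_split; apply: eq_bigr => p _ /=.
by rewrite derM /= tensDl !tensZ [p.1 * _]mulrC.
Qed.

End TensorBracket.

Section BaseChange.
Variables (K : realType) (S R : comAlg K) (psi : alg_hom S R) (B : lr_pair S).
Local Notation T := (tensor psi B).

Definition bchange_pred : {pred Der R * T} :=
  fun v => der_precomp psi v.1 == tens_anchor v.2.

Fact bchange_submod : GRing.submod_closed bchange_pred.
Proof.
split=> [|r v w]; rewrite !unfold_in; first by rewrite !raddf0.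
move=> /eqP ev /eqP ew; rewrite [der_precomp _ _]linearP [tens_anchor _]linearP.
by rewrite /= ev ew.
Qed.
HB.instance Definition _ := GRing.isSubmodClosed.Build R _ bchange_pred
  bchange_submod.

(* The fiber product  Der(R) x_{Der(S,R)} (R (x)_S B).                        *)
Record bchange := BChange {
  bchange_val : Der R * T;
  bchange_valP : bchange_val \in bchange_pred
}.
HB.instance Definition _ := [isSub for bchange_val].
HB.instance Definition _ := [Choice of bchange by <:].
HB.instance Definition _ := [SubChoice_isSubLmodule of bchange by <:].

Implicit Types v w : bchange.

Lemma bchange_compat v :
  der_precomp psi (bchange_val v).1 =
  tens_anchor (tsum psi (repr (bchange_val v).2)).
Proof. by rewrite tsum_repr; apply/eqP/(bchange_valP v). Qed.

Definition bchange_bracket_val v w : Der R * T :=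
  (comm_der (bchange_val v).1 (bchange_val w).1,
   tbracket psi (bchange_val v).1 (repr (bchange_val v).2)
            (bchange_val w).1 (repr (bchange_val w).2)).

Fact bchange_bracketP v w : bchange_bracket_val v w \in bchange_pred.
Proof.
by rewrite unfold_in /=; apply/eqP/tens_anchor_tbracket; apply: bchange_compat.
Qed.

Definition bchange_bracket v w : bchange := BChange (bchange_bracketP v w).

(* The bracket does not depend on the chosen representatives.                 *)
Lemma bchange_bracketE v w x y :
    (bchange_val v).2 = tsum psi x -> (bchange_val w).2 = tsum psi y ->
  (bchange_val (bchange_bracket v w)).2 =
  tbracket psi (bchange_val v).1 x (bchange_val w).1 y.
Proof.
move=> vx wy; apply: tbracket_repr; rewrite ?tsum_repr //.
  exact/eqP/(bchange_valP v).
exact/eqP/(bchange_valP w).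
Qed.

Lemma bchange_ext v w : (bchange_val v).1 = (bchange_val w).1 ->
  (bchange_val v).2 = (bchange_val w).2 -> v = w.
Proof.
move=> e1 e2; apply: val_inj; rewrite /= [LHS]surjective_pairing.
by rewrite [RHS]surjective_pairing e1 e2.
Qed.

Definition bchange_anchor v : Der R := (bchange_val v).1.
Fact bchange_anchor_linear : linear bchange_anchor. Proof. by []. Qed.
HB.instance Definition _ := GRing.isLinear.Build R bchange (Der R) _
  bchange_anchor bchange_anchor_linear.

Definition bchange_proj v : T := (bchange_val v).2.
Fact bchange_proj_linear : linear bchange_proj. Proof. by []. Qed.
HB.instance Definition _ := GRing.isLinear.Build R bchange T _
  bchange_proj bchange_proj_linear.

Lemma comm_derC (D E : Der R) : comm_der D E = - comm_der E D.
Proof. by apply: der_ext => r /=; rewrite opprB. Qed.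
Lemma comm_der_addr (D E F : Der R) :
  comm_der D (E + F) = comm_der D E + comm_der D F.
Proof.
by apply: der_ext => r /=; rewrite derD opprD addrACA.
Qed.

Fact bchange_bracketC v w : bchange_bracket v w = - bchange_bracket w v.
Proof. by apply: bchange_ext => /=; [apply: comm_derC | apply: tbracketC]. Qed.
Fact bchange_bracketDr v w w' :
  bchange_bracket v (w + w') = bchange_bracket v w + bchange_bracket v w'.
Proof.
apply: bchange_ext => /=; first exact: comm_der_addr.
rewrite -tbracketDr; apply: tbracket_reprr; first exact: bchange_compat.
by rewrite tsum_cat !tsum_repr.
Qed.
Fact bchange_leibniz v w (r : R) : bchange_bracket v (r *: w) =
  r *: bchange_bracket v w + bchange_anchor v r *: w.
Proof.
apply: bchange_ext => /=.
  apply: der_ext => s /=; rewrite derM /= mulrBr addrAC.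
  by rewrite [(bchange_val w).1 s * _]mulrC.
rewrite -[in X in _ + X](tsum_repr (bchange_val w).2) -tbracketZr.
apply: tbracket_reprr; first exact: bchange_compat.
rewrite tsum_repr /tsum big_map -[in LHS](tsum_repr (bchange_val w).2).
by rewrite scaler_sumr; apply: eq_bigr => p _; rewrite tensZ.
Qed.
Fact bchange_bracketDl v v' w :
  bchange_bracket (v + v') w = bchange_bracket v w + bchange_bracket v' w.
Proof. by rewrite bchange_bracketC bchange_bracketDr opprD -!bchange_bracketC. Qed.
Fact bchange_bracketZr (k : K) v w :
  bchange_bracket v (k%:S *: w) = k%:S *: bchange_bracket v w.
Proof. by rewrite bchange_leibniz der_in scale0r addr0. Qed.
Fact bchange_bracketZl (k : K) v w :
  bchange_bracket (k%:S *: v) w = k%:S *: bchange_bracket v w.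
Proof.
by rewrite bchange_bracketC bchange_bracketZr -scalerN -bchange_bracketC.
Qed.
Fact bchange_bracketxx v : bchange_bracket v v = 0.
Proof.
apply: bchange_ext => /=; first by apply: der_ext => r /=; rewrite subrr.
set t := tbracket _ _ _ _ _; have /eqP : t = - t by apply: tbracketC.
rewrite -addr_eq0 => /eqP t2; rewrite -[t]scale1r -(rmorph1 (comalg_in R)).
have K2 : (2 : K) != 0 by rewrite pnatr_eq0.
rewrite -(mulVf K2) rmorphM rmorphD rmorph1 -scalerA scalerDl.
by rewrite scale1r t2 scaler0.
Qed.
Fact bchange_jacobi u v w :
  bchange_bracket u (bchange_bracket v w) + bchange_bracket v (bchange_bracket w u)
    + bchange_bracket w (bchange_bracket u v) = 0.
Proof.
apply: bchange_ext => /=; last by apply: tbracket_jacobi; apply: bchange_compat.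
apply: der_ext => r; rewrite !add_derE /= !derD !derN.
exact: commutator_sum0.
Qed.

Definition bchange_lr : lr_pair R :=
  @LRPair K R bchange bchange_bracket bchange_anchor bchange_bracketDl
    bchange_bracketDr bchange_bracketZl bchange_bracketZr bchange_bracketxx
    bchange_jacobi (fun _ _ => erefl) bchange_leibniz.

End BaseChange.

Section IdTensor.
Variables (S R : comPzRingType) (psi : {rmorphism S -> R}).
Variables (B C : lmodType S) (G : {linear B -> C}).

Definition id_tens : tensor psi B -> tensor psi C :=
  tlift (fun c e => tens psi c (G e)).

Fact id_tens_balanced : balanced psi (fun c e => tens psi c (G e)).
Proof.
split=> [c c' e|c e e'|c s e]; first exact: tensDl.
  by rewrite raddfD tensDr.
by rewrite tensM linearZ.
Qed.
Fact id_tens_linear : linear id_tens.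
Proof.
by apply: tlift_linear; [exact: id_tens_balanced | move=> r c e; rewrite tensZ].
Qed.
HB.instance Definition _ := GRing.isLinear.Build R (tensor psi B) (tensor psi C)
  _ id_tens id_tens_linear.

Lemma id_tensE c e : id_tens (tens psi c e) = tens psi c (G e).
Proof. exact/tliftE/id_tens_balanced. Qed.
End IdTensor.
Arguments id_tens {S R} psi {B C} G t.

(* The canonical isomorphism  R (x)_S (S (x)_T C) -> R (x)_T C,               *)
(* r (x) (s (x) c) |-> r psi(s) (x) c.                                        *)
Section TensorAssociativity.
Variables (T S R : comPzRingType).
Variables (psi : {rmorphism S -> R}) (chi : {rmorphism T -> S}) (C : lmodType T).
Local Notation tensRT := (tens (psi \o chi : {rmorphism T -> R})).

Definition tens_assoc :
    tensor psi (tensor chi C) -> tensor (psi \o chi : {rmorphism T -> R}) C :=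
  tlift (fun r => tlift (fun s c => tensRT (r * psi s) c)).

Fact tens_assoc_balanced1 r : balanced chi (fun s (c : C) => tensRT (r * psi s) c).
Proof.
split=> [s s' c|s c c'|s t c].
- by rewrite rmorphD mulrDr tensDl.
- exact: tensDr.
- by rewrite rmorphM mulrA -tensM.
Qed.
Fact tens_assoc_balanced : balanced psi
  (fun r => @tlift _ _ chi C _ (fun s c => tensRT (r * psi s) c)).
Proof.
have bal := tens_assoc_balanced1.
split=> [r r' t|r t t'|r s t]; last 1 first.
- rewrite -[t]tsum_repr {2}/tsum scaler_sumr.
  rewrite (big_morph _ (tliftD (bal r)) (tlift0 (bal r))) tlift_sum //.
  by apply: eq_bigr => p _; rewrite tensZ tliftE // rmorphM mulrA.
- rewrite -big_split; apply: eq_bigr => p _ /=.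
  by rewrite mulrDl tensDl.
- exact: tliftD.
Qed.
Fact tens_assoc_linear : linear tens_assoc.
Proof.
apply: tlift_linear; first exact: tens_assoc_balanced.
move=> r r' t; rewrite /tlift scaler_sumr; apply: eq_bigr => p _.
by rewrite tensZ mulrA.
Qed.
HB.instance Definition _ := GRing.isLinear.Build R
  (tensor psi (tensor chi C)) (tensor (psi \o chi : {rmorphism T -> R}) C)
  _ tens_assoc tens_assoc_linear.

Lemma tens_assocE r s c :
  tens_assoc (tens psi r (tens chi s c)) = tensRT (r * psi s) c.
Proof.
rewrite /tens_assoc (tliftE tens_assoc_balanced).
exact: (tliftE (tens_assoc_balanced1 r)).
Qed.
End TensorAssociativity.
Arguments tens_assoc {T S R} psi chi C t.

(* The conditions are required for every expression of F(a), F(b) as a sum.   *)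
Record comorphism (K : realType) (R S : comAlg K) (A : lr_pair R) (B : lr_pair S)
    := Comorphism {
  com_hom : alg_hom S R;
  com_map : {linear A -> tensor com_hom B};
  com_anchor : forall (a : A) (x : seq (R * B)), com_map a = tsum com_hom x ->
    forall s : S, lr_anchor A a (com_hom s) =
      \sum_(p <- x) p.1 * com_hom (lr_anchor B p.2 s);
  com_bracket : forall (a b : A) (x y : seq (R * B)),
    com_map a = tsum com_hom x -> com_map b = tsum com_hom y ->
    com_map (lr_bracket a b) =
      tbracket com_hom (lr_anchor A a) x (lr_anchor A b) y
}.

Section ComorphismTheory.
Variables (K : realType) (R S : comAlg K) (A : lr_pair R) (B : lr_pair S).

Lemma com_compat (F : comorphism A B) a :
  der_precomp (com_hom F) (lr_anchor A a) = tens_anchor (com_map F a).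
Proof.
apply: der_ext => s; rewrite -[com_map F a]tsum_repr tens_anchorE.
exact: com_anchor (esym (tsum_repr _)) s.
Qed.
End ComorphismTheory.

Section Composition.
Variables (K : realType) (R S T : comAlg K).
Variables (A : lr_pair R) (B : lr_pair S) (C : lr_pair T).
Variables (G : comorphism B C) (F : comorphism A B).
Local Notation psi := (com_hom F).
Local Notation chi := (com_hom G).

Definition com_comp_map : {linear A -> tensor (comp_hom psi chi) C} :=
  tens_assoc psi chi C \o (id_tens psi (com_map G) \o com_map F).

Local Notation phi := (comp_hom psi chi).
Let J (t : tensor psi B) : tensor phi C :=
  tens_assoc psi chi C (id_tens psi (com_map G) t).
Let formal_comp (x : seq (R * B)) : seq (R * C) :=
  [seq (p.1 * psi q.1, q.2) | p <- x, q <- repr (com_map G p.2)].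

Let assoc_tsum c (y : seq (S * C)) :
  tens_assoc psi chi C (tens psi c (tsum chi y)) =
  \sum_(q <- y) tens phi (c * psi q.1) q.2.
Proof.
rewrite /tsum tens_sumr raddf_sum; apply: eq_bigr => q _; exact: tens_assocE.
Qed.
Let JD : {morph J : t u / t + u}.
Proof. by move=> t u; rewrite /J !raddfD. Qed.
Let JB : {morph J : t u / t - u}.
Proof. by move=> t u; rewrite /J !raddfB. Qed.
Let J_sum (I : Type) (l : seq I) (f : I -> tensor psi B) :
  J (\sum_(i <- l) f i) = \sum_(i <- l) J (f i).
Proof.
by rewrite /J (raddf_sum (id_tens psi (com_map G))) (raddf_sum (tens_assoc psi chi C)).
Qed.
Let J_tens c e y : com_map G e = tsum chi y ->
  J (tens psi c e) = \sum_(q <- y) tens phi (c * psi q.1) q.2.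
Proof. by rewrite /J id_tensE => ->; apply: assoc_tsum. Qed.
Let J_tsum x : J (tsum psi x) = tsum phi (formal_comp x).
Proof.
rewrite /tsum big_allpairs_dep J_sum; apply: eq_bigr => p _.
by apply: J_tens; rewrite tsum_repr.
Qed.

Let J_anchor x s : tens_anchor (J (tsum psi x)) s =
  \sum_(p <- x) p.1 * psi (lr_anchor B p.2 (chi s)).
Proof.
rewrite J_tsum tens_anchorE big_allpairs_dep; apply: eq_bigr => p _ /=.
rewrite (com_anchor (esym (tsum_repr (com_map G p.2)))) rmorph_sum mulr_sumr.
by apply: eq_bigr => q _; rewrite rmorphM mulrA.
Qed.

Let J_tbracket D x D' y :
    der_precomp psi D = tens_anchor (tsum psi x) ->
    der_precomp psi D' = tens_anchor (tsum psi y) ->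
  J (tbracket psi D x D' y) =
  tbracket phi D (formal_comp x) D' (formal_comp y).
Proof.
move=> Dx Dy.
have Dxs s : D (psi s) = \sum_(p <- x) p.1 * psi (lr_anchor B p.2 s).
  by rewrite -tens_anchorE -Dx.
have Dys s : D' (psi s) = \sum_(p <- y) p.1 * psi (lr_anchor B p.2 s).
  by rewrite -tens_anchorE -Dy.
rewrite /tbracket JB JD !J_sum !big_allpairs_dep /=.
pose g (p : R * B) := repr (com_map G p.2).
pose X1 := \sum_(p <- x) \sum_(q <- y) \sum_(k <- g p) \sum_(l <- g q)
  tens phi (p.1 * psi k.1 * (q.1 * psi l.1)) (lr_bracket k.2 l.2).
pose X2 := \sum_(q <- y) \sum_(l <- g q) \sum_(p <- x)
  tens phi (q.1 * (p.1 * psi (lr_anchor B p.2 l.1))) l.2.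
pose X3 := \sum_(p <- x) \sum_(k <- g p) \sum_(q <- y)
  tens phi (p.1 * (q.1 * psi (lr_anchor B q.2 k.1))) k.2.
pose Y2 := \sum_(q <- y) \sum_(l <- g q) tens phi (D q.1 * psi l.1) l.2.
pose Y3 := \sum_(p <- x) \sum_(k <- g p) tens phi (D' p.1 * psi k.1) k.2.
have -> : \sum_(p <- x) J (\sum_(q <- y) tens psi (p.1 * q.1) (lr_bracket p.2 q.2))
    = X1 + X2 - X3.
  have -> : X2 = \sum_(p <- x) \sum_(q <- y) \sum_(l <- g q)
      tens phi (q.1 * (p.1 * psi (lr_anchor B p.2 l.1))) l.2.
    by rewrite [RHS]exchange_big; apply: eq_bigr => q _; apply: exchange_big.
  have -> : X3 = \sum_(p <- x) \sum_(q <- y) \sum_(k <- g p)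
      tens phi (p.1 * (q.1 * psi (lr_anchor B q.2 k.1))) k.2.
    by apply: eq_bigr => p _; apply: exchange_big.
  rewrite -big_split -sumrB; apply: eq_bigr => p _ /=.
  rewrite J_sum -big_split -sumrB; apply: eq_bigr => q _ /=.
  have Gp := esym (tsum_repr (com_map G p.2)).
  have Gq := esym (tsum_repr (com_map G q.2)).
  rewrite /J id_tensE (com_bracket Gp Gq) /tbracket.
  rewrite 2!tensDr tensNr (raddfB (tens_assoc psi chi C)).
  rewrite (raddfD (tens_assoc psi chi C)).
  congr (_ + _ - _); rewrite tens_sumr (raddf_sum (tens_assoc psi chi C)).
  - apply: eq_bigr => k _; rewrite tens_sumr (raddf_sum (tens_assoc psi chi C)).
    by apply: eq_bigr => l _; rewrite /= tens_assocE rmorphM mulrACA.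
  - by apply: eq_bigr => l _; rewrite /= tens_assocE mulrA [q.1 * _]mulrC.
  - by apply: eq_bigr => k _; rewrite /= tens_assocE mulrA.
have -> : \sum_(q <- y) J (tens psi (D q.1) q.2) = Y2.
  by apply: eq_bigr => q _; apply: J_tens; rewrite tsum_repr.
have -> : \sum_(p <- x) J (tens psi (D' p.1) p.2) = Y3.
  by apply: eq_bigr => p _; apply: J_tens; rewrite tsum_repr.
have -> : \sum_(q <- y) \sum_(l <- g q) tens phi (D (q.1 * psi l.1)) l.2 = X2 + Y2.
  rewrite -big_split; apply: eq_bigr => q _; rewrite -big_split.
  apply: eq_bigr => l _; rewrite derM /= tensDl Dxs mulr_sumr tens_suml.
  by rewrite [psi l.1 * _]mulrC.
have -> : \sum_(p <- x) \sum_(k <- g p) tens phi (D' (p.1 * psi k.1)) k.2 = X3 + Y3.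
  rewrite -big_split; apply: eq_bigr => p _; rewrite -big_split.
  apply: eq_bigr => k _; rewrite derM /= tensDl Dys mulr_sumr tens_suml.
  by rewrite [psi k.1 * _]mulrC.
set Z1 := \sum_(p <- x) _.
have -> : Z1 = X1.
  apply: eq_bigr => p _; under eq_bigr do rewrite big_allpairs_dep.
  exact: exchange_big.
move: X1 X2 X3 Y2 Y3 => *; rewrite opprD !addrA; congr (_ - _).
by rewrite addrAC.
Qed.

Fact com_comp_compat a :
  der_precomp phi (lr_anchor A a) = tens_anchor (com_comp_map a).
Proof.
apply: der_ext => s; rewrite -[com_comp_map a]/(J (com_map F a)).
rewrite -[com_map F a]tsum_repr J_anchor.
exact: (com_anchor (esym (tsum_repr _)) (chi s)).
Qed.

Fact com_comp_anchor a x : com_comp_map a = tsum phi x -> forall s : T,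
  lr_anchor A a (phi s) = \sum_(p <- x) p.1 * phi (lr_anchor C p.2 s).
Proof. by move=> ax s; rewrite -tens_anchorE -ax -com_comp_compat. Qed.

Fact com_comp_bracket a b x y :
    com_comp_map a = tsum phi x -> com_comp_map b = tsum phi y ->
  com_comp_map (lr_bracket a b) =
    tbracket phi (lr_anchor A a) x (lr_anchor A b) y.
Proof.
move=> ax bx; have Fa := esym (tsum_repr (com_map F a)).
have Fb := esym (tsum_repr (com_map F b)).
rewrite -[LHS]/(J (com_map F (lr_bracket a b))) (com_bracket Fa Fb).
rewrite J_tbracket -?Fa -?Fb; try exact: com_compat.
apply: tbracket_repr; rewrite -?J_tsum -?Fa -?Fb -?ax -?bx //.
  exact: com_comp_compat.
exact: com_comp_compat.
Qed.

Definition com_comp : comorphism A C :=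
  Comorphism com_comp_anchor com_comp_bracket.

End Composition.

Section Projection.
Variables (K : realType) (S R : comAlg K) (psi : alg_hom S R) (B : lr_pair S).

Fact bchange_proj_anchor (v : bchange_lr psi B) x :
  bchange_proj v = tsum psi x -> forall s,
  lr_anchor (bchange_lr psi B) v (psi s) =
    \sum_(p <- x) p.1 * psi (lr_anchor B p.2 s).
Proof.
move=> vx s; rewrite -tens_anchorE -vx.
by have /eqP <- := bchange_valP v.
Qed.

Definition bchange_proj_com : comorphism (bchange_lr psi B) B :=
  @Comorphism K R S (bchange_lr psi B) B psi (@bchange_proj K S R psi B)
    bchange_proj_anchor
    (fun v w x y vx wy => bchange_bracketE vx wy).
End Projection.

(* Main.v *)
Require Import Defs.
From HB Require Import structures.
From mathcomp Require Import all_boot all_order all_algebra.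
From mathcomp Require Import boolp reals.

(** A comorphism over the identity of R amounts, through the isomorphism
    R (x)_R C = C, to an R-linear map commuting with anchors and brackets
    ([com_of_linear], and [com_id_ext] for the injectivity of this dictionary).
    Under it, composing with the projection of the base change is ordinary
    composition ([collapse_comp]).  So a lift of F is a linear map from A to the
    fiber product Der(R) x (R (x)_S B) over Der(S,R): its second component must
    be F by the factorization, and its first must be the anchor of A because the
    anchor of the base change is the first projection ([collapse_anchor]).
    Conversely a |-> (L_a, F(a)) lands in the fiber product: this is exactly the
    anchor condition on F ([com_compat]), and the bracket condition on F says
    that this map preserves brackets.

    The composite covers idfun \o psi, a bundled morphism which is only
    provably equal to psi, so that the two sides of the factorization have maps
    into different tensor products.  They are compared by [tens_recast], which
    rereads a formal sum in the other tensor product. *)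

Set Implicit Arguments.
Unset Strict Implicit.
Unset Printing Implicit Defensive.

Import GRing.Theory.
Local Open Scope ring_scope.

Lemma rmorphism_ext (S R : pzRingType) (f g : {rmorphism S -> R}) :
  f =1 g -> f = g.
Proof.
case: f g => f [[f0] [fM]] [g [[g0] [gM]]] /= /funext fg.
case: g / fg g0 gM => g0 gM.
by rewrite (Prop_irrelevance g0 f0) (Prop_irrelevance gM fM).
Qed.

Lemma linear_ext (R : pzRingType) (U V : lmodType R) (f g : {linear U -> V}) :
  f =1 g -> f = g.
Proof.
case: f g => f [[f0] [fZ]] [g [[g0] [gZ]]] /= /funext fg.
case: g / fg g0 gZ => g0 gZ.
by rewrite (Prop_irrelevance g0 f0) (Prop_irrelevance gZ fZ).
Qed.

Lemma alg_hom_ext (K : realType) (S R : comAlg K) (f g : alg_hom S R) :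
  f =1 g -> f = g.
Proof.
case: f g => f fK [g gK] /= /rmorphism_ext fg; case: g / fg gK => gK.
by rewrite (Prop_irrelevance gK fK).
Qed.

Section Recast.
Variables (S R : comPzRingType) (psi psi' : {rmorphism S -> R}) (B : lmodType S).

Definition tens_recast : tensor psi B -> tensor psi' B :=
  tlift (fun c e => tens psi' c e).

Lemma tens_recast_tsum x : psi =1 psi' ->
  tens_recast (tsum psi x) = tsum psi' x.
Proof.
move=> eq_psi; apply: tlift_sum; split=> [c c' e|c e e'|c s e].
- exact: tensDl.
- exact: tensDr.
- by rewrite eq_psi tensM.
Qed.
End Recast.
Arguments tens_recast {S R psi} psi' {B} t.

Section Collapse.
Variables (R : comPzRingType) (h : {rmorphism R -> R}) (M : lmodType R).
Hypothesis h_id : h =1 id.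

(** The isomorphism of R (x)_R M with M.  The morphism h stands for the
    identity up to a propositional equality, because the one a comorphism
    covers is a field of a record. *)
Definition collapse : tensor h M -> M := tlift (fun c e => c *: e).

Lemma collapse_tsum x : collapse (tsum h x) = \sum_(p <- x) p.1 *: p.2.
Proof.
apply: tlift_sum; split=> [c c' e|c e e'|c s e].
- exact: scalerDl.
- exact: scalerDr.
- by rewrite h_id scalerA.
Qed.

Lemma collapse_tens c e : collapse (tens h c e) = c *: e.
Proof. by have := collapse_tsum [:: (c, e)]; rewrite /tsum !big_seq1. Qed.

Lemma collapseK t : tens h 1 (collapse t) = t.
Proof.
rewrite -[t in RHS]tsum_repr -[t in LHS]tsum_repr collapse_tsum tens_sumr.
by apply: eq_bigr => p _; rewrite -tensM mul1r h_id.
Qed.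
End Collapse.

Section Extensionality.
Variables (K : realType) (R S : comAlg K) (A : lr_pair R) (B : lr_pair S).
Implicit Types F G : comorphism A B.

(** The maps of F and G have different codomains; comparing them by
    [tens_recast] avoids a transport along com_hom F = com_hom G. *)
Lemma com_extP F G : F = G <->
  com_hom F =1 com_hom G /\
  forall a, tens_recast (com_hom G) (com_map F a) = com_map G a.
Proof.
split=> [<-|[]].
  by split=> // a; rewrite -[com_map F a]tsum_repr tens_recast_tsum.
case: F G => f m m_anc m_br [g n n_anc n_br] /= /alg_hom_ext fg.
case: g / fg n n_anc n_br => n n_anc n_br mn.
have {}mn : m = n.
  by apply: linear_ext => a; rewrite -mn -[m a]tsum_repr tens_recast_tsum.
case: n / mn n_anc n_br => n_anc n_br.
by rewrite (Prop_irrelevance n_anc m_anc) (Prop_irrelevance n_br m_br).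
Qed.
End Extensionality.

Section OverIdentity.
Variables (K : realType) (R : comAlg K) (A C : lr_pair R).

Lemma com_id_ext (F G : comorphism A C) :
    com_hom F = id_hom R -> com_hom G = id_hom R ->
    (forall a, collapse (com_map F a) = collapse (com_map G a)) ->
  F = G.
Proof.
move=> Fid Gid FG.
have F1 : com_hom F =1 id by move=> r; rewrite Fid.
have G1 : com_hom G =1 id by move=> r; rewrite Gid.
have F1G : com_hom F =1 com_hom G by move=> r; rewrite F1 G1.
apply/com_extP; split=> // a.
rewrite -(collapseK F1 (com_map F a)) FG -[RHS](collapseK G1).
by have := tens_recast_tsum [:: (1, collapse (com_map G a))] F1G;
  rewrite /tsum !big_seq1.
Qed.

(** Since psi = id, the anchor condition reads L_a = \sum_i c_i L_(e_i) for any
    expression of F(a), and the right-hand side is the anchor of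
    \sum_i c_i e_i. *)
Lemma collapse_anchor (F : comorphism A C) a : com_hom F = id_hom R ->
  lr_anchor C (collapse (com_map F a)) = lr_anchor A a.
Proof.
move=> Fid; have F1 r : com_hom F r = r by rewrite Fid.
apply: der_ext => r; rewrite -[r in RHS]F1.
rewrite (com_anchor (esym (tsum_repr (com_map F a)))).
rewrite -[com_map F a in LHS]tsum_repr (collapse_tsum F1) raddf_sum sum_derE.
by apply: eq_bigr => p _; rewrite F1 [LHS]/= linearZ.
Qed.

(** The inverse dictionary: f becomes a |-> 1 (x) f(a).  The two conditions must
    hold for every expression of 1 (x) f(a) as a formal sum; since f
    commutes with anchors, the right-hand sides depend only on the class of that
    sum, and it suffices to consider the one-term expression. *)
Section OfLinear.
Variable f : {linear A -> C}.
Hypothesis f_anchor : forall a, lr_anchor C (f a) = lr_anchor A a.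
Hypothesis f_bracket : forall a b, f (lr_bracket a b) = lr_bracket (f a) (f b).

Definition one_tens (a : A) : tensor (id_hom R) C := tens (id_hom R) 1 (f a).

Fact one_tens_linear : linear one_tens.
Proof.
move=> r a b; rewrite /one_tens linearP tensDr; congr (_ + _).
by rewrite tensZ mulr1 -tensM mul1r.
Qed.
HB.instance Definition _ := GRing.isLinear.Build R A (tensor (id_hom R) C) _
  one_tens one_tens_linear.

Lemma one_tensE a : one_tens a = tsum (id_hom R) [:: (1, f a)].
Proof. by rewrite /tsum big_seq1. Qed.

Lemma one_tens_compat a :
  der_precomp (id_hom R) (lr_anchor A a) = tens_anchor (one_tens a).
Proof.
apply: der_ext => s; rewrite one_tensE tens_anchorE big_seq1 /= mul1r.
by rewrite f_anchor.
Qed.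

Fact one_tens_anchor a x : one_tens a = tsum (id_hom R) x -> forall s,
  lr_anchor A a (id_hom R s) = \sum_(p <- x) p.1 * id_hom R (lr_anchor C p.2 s).
Proof. by move=> ax s; rewrite -tens_anchorE -ax -one_tens_compat. Qed.

Fact one_tens_bracket a b x y :
    one_tens a = tsum (id_hom R) x -> one_tens b = tsum (id_hom R) y ->
  one_tens (lr_bracket a b) =
    tbracket (id_hom R) (lr_anchor A a) x (lr_anchor A b) y.
Proof.
move=> ax bx; have := one_tens_compat a; have := one_tens_compat b.
rewrite !one_tensE => cb ca; move: ax bx; rewrite !one_tensE => ax bx.
(* On one-term expressions the derivative terms vanish, as D 1 = 0. *)
rewrite -(tbracket_repr ca cb ax bx) /tbracket /tsum !big_seq1 /= !der1 !tens0l.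
by rewrite mulr1 addr0 subr0 f_bracket.
Qed.

Definition com_of_linear : comorphism A C :=
  Comorphism one_tens_anchor one_tens_bracket.

Lemma collapse_of_linear a : collapse (com_map com_of_linear a) = f a.
Proof. by rewrite collapse_tens // scale1r. Qed.
End OfLinear.
End OverIdentity.

(** The composite sends the term c (x) e of F(a) to c G(e), which is G(c e)
    because G is R-linear. *)
Lemma collapse_comp (K : realType) (R S : comAlg K) (A C : lr_pair R)
    (B : lr_pair S) (G : comorphism C B) (F : comorphism A C) a :
    com_hom F = id_hom R ->
  tens_recast (com_hom G) (com_map (com_comp G F) a) =
  com_map G (collapse (com_map F a)).
Proof.
move=> Fid; have F1 r : com_hom F r = r by rewrite Fid.
set phi := comp_hom (com_hom F) (com_hom G).
pose x := [seq (p.1 * com_hom F q.1, q.2)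
  | p <- repr (com_map F a), q <- repr (com_map G p.2)].
have -> : com_map (com_comp G F) a = tsum phi x.
  rewrite /= -{1}[com_map F a]tsum_repr /tsum.
  rewrite (raddf_sum (id_tens _ (com_map G))) (raddf_sum (tens_assoc _ _ B)).
  rewrite big_allpairs_dep; apply: eq_bigr => p _ /=.
  rewrite id_tensE -[com_map G p.2 in LHS]tsum_repr /tsum tens_sumr raddf_sum.
  by apply: eq_bigr => q _; apply: tens_assocE.
rewrite tens_recast_tsum; last by move=> s; apply: F1.
rewrite -[com_map F a in RHS]tsum_repr (collapse_tsum F1) raddf_sum.
rewrite /tsum big_allpairs_dep; apply: eq_bigr => p _ /=.
rewrite linearZ -[com_map G p.2 in RHS]tsum_repr /tsum [RHS]scaler_sumr.
by apply: eq_bigr => q _; rewrite F1 tensZ.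
Qed.

Section BaseChangeLift.
Variables (K : realType) (R S : comAlg K) (A : lr_pair R) (B : lr_pair S).
Variable F : comorphism A B.
Local Notation psi := (com_hom F).

Fact bchange_pairP a : (lr_anchor A a, com_map F a) \in @bchange_pred _ _ _ psi B.
Proof. by rewrite unfold_in; apply/eqP/com_compat. Qed.

Definition bchange_pair (a : A) : bchange_lr psi B := BChange (bchange_pairP a).

Fact bchange_pair_linear : linear bchange_pair.
Proof. by move=> r a b; apply: bchange_ext; rewrite /= linearP. Qed.
HB.instance Definition _ := GRing.isLinear.Build R A (bchange_lr psi B) _
  bchange_pair bchange_pair_linear.

Lemma bchange_pair_bracket a b :
  bchange_pair (lr_bracket a b) = lr_bracket (bchange_pair a) (bchange_pair b).
Proof.
apply: bchange_ext => /=; first exact: lr_anchor_bracket.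
by apply: com_bracket; rewrite tsum_repr.
Qed.

Definition bchange_lift : comorphism A (bchange_lr psi B) :=
  @com_of_linear _ _ _ _ bchange_pair (fun=> erefl) bchange_pair_bracket.

Lemma com_comp_bchange_lift : F = com_comp (bchange_proj_com psi B) bchange_lift.
Proof.
apply/esym/com_extP; split=> // a.
rewrite -[com_hom F]/(com_hom (bchange_proj_com psi B)) collapse_comp //.
by rewrite collapse_of_linear.
Qed.

Lemma collapse_bchange_factor (G : comorphism A (bchange_lr psi B)) a :
    com_hom G = id_hom R -> F = com_comp (bchange_proj_com psi B) G ->
  collapse (com_map G a) = bchange_pair a.
Proof.
move=> Gid FG; apply: bchange_ext; first exact: (collapse_anchor a Gid).
have [_ /(_ a) /= <-] := (com_extP _ _).1 (esym FG).
by rewrite -[com_hom F]/(com_hom (bchange_proj_com psi B)) collapse_comp.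
Qed.
End BaseChangeLift.

Theorem theorem2p21 (K : realType) (R S : comAlg K)
    (A : lr_pair R) (B : lr_pair S) (F : comorphism A B) :
  exists! Fbar : comorphism A (bchange_lr (com_hom F) B),
    com_hom Fbar = id_hom R /\
    F = com_comp (bchange_proj_com (com_hom F) B) Fbar.
Proof.
exists (bchange_lift F); split; first by split=> //; apply: com_comp_bchange_lift.
move=> G [Gid FG]; apply: com_id_ext => // a.
by rewrite collapse_of_linear (collapse_bchange_factor a Gid FG).
Qed.
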